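(* Fix a constant $\eta > 0$ and a positive integer $c$. Let $k = k(p)$ satisfy $k\to\infty$ and $k = o(p)$ as $p\to\infty$, and suppose that the number of tests satisfies $n \ge (1+\eta)\,2c\log_2\frac{p}{k}$. Then there exists a (sequence, indexed by $p$, of) non-adaptive test design with $n$ tests and decoder that outputs an estimate $\mathcal{I}\in\{0,1,\dots,p\}$ of a definite defective (with $0$ representing ''I don't know'') satisfying $$ \mathbb{P}[\mathcal{I}>0 \,\cap\, \mathcal{I}\notin S] = 0 \quad\text{and}\quad \mathbb{P}[\mathcal{I}=0] \le (1-e^{-1}+o(1))^c $$ as $k\to\infty$ and $p \to \infty$.
   Context: Probabilistic (noiseless) group testing: there are $p$ items $\{1,\dots,p\}$, and the defective set $S$ is uniformly distributed over the $\binom{p}{k}$ subsets of $\{1,\dots,p\}$ of cardinality $k$. A non-adaptive test design with $n$ tests is a (possibly random) matrix $\mathbf{X} \in \{0,1\}^{n\times p}$, independent of $S$, whose entry $X^{(i)}_j$ equals $1$ iff item $j$ is included in test $i$. The outcomes are $\mathbf{Y} \in \{0,1\}^n$ with $Y^{(i)} = \bigvee_{j \in S} X^{(i)}_j$. The decoder computes $\mathcal{I}$ from $(\mathbf{X},\mathbf{Y})$ (and knowledge of $p,k$ and of the randomness used to generate the design). Probabilities are over $S$ and $\mathbf{X}$. *)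

(* Defs.v *)
From HB Require Import structures.
From mathcomp Require Import all_boot all_order all_algebra.
From mathcomp Require Import all_classical all_reals all_analysis.

Set Implicit Arguments.
Unset Strict Implicit.
Unset Printing Implicit Defensive.

Import Order.TTheory GRing.Theory Num.Theory.
Import numFieldNormedType.Exports.

Local Open Scope classical_set_scope.
Local Open Scope ring_scope.

Definition log2 (R : realType) (x : R) : R := ln x / ln 2.

(* Items are 'I_p (item j of {1, ..., p} is the ordinal j - 1) and tests are
   'I_n; X i j is true iff item j is included in test i. *)
Notation test_matrix n p := 'M[bool]_(n, p) (only parsing).

(* A possibly random design is the law of its test matrix; as there are
   finitely many n x p matrices, a mass function loses no generality.
   Deterministic designs are the point masses. *)
Record random_design (R : realType) (n p : nat) := RandomDesign {
  design_mass :> test_matrix n p -> R;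
  design_mass_ge0 : forall X, 0 <= design_mass X;
  design_mass_sum1 : \sum_X design_mass X = 1 }.

Definition outcomes n p (X : test_matrix n p) (S : {set 'I_p}) :
    {ffun 'I_n -> bool} :=
  [ffun i => [exists j in S, X i j]].

(* The estimate: Some j names item j, None is the answer 0, "I don't know".
   A decoder may be chosen depending on p, k and the law of the design. *)
Definition decoder n p :=
  test_matrix n p -> {ffun 'I_n -> bool} -> option 'I_p.

Definition estimate n p (D : decoder n p) (X : test_matrix n p)
    (S : {set 'I_p}) : option 'I_p :=
  D X (outcomes X S).

(* P[E(X, S)] for X with law mu and, independently of X, S uniform over the
   subsets of 'I_p of cardinality k; meaningful for k <= p. *)
Definition gt_prob (R : realType) n p (k : nat) (mu : random_design R n p)
    (E : test_matrix n p -> {set 'I_p} -> bool) : R :=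
  \sum_X \sum_(S : {set 'I_p} | (#|S| == k) && E X S) mu X / 'C(p, k)%:R.

Lemma gt_prob_total (R : realType) n p k (mu : random_design R n p) :
  (k <= p)%N -> gt_prob k mu (fun _ _ => true) = 1.
Proof.
move=> kp; rewrite -(design_mass_sum1 mu); apply: eq_bigr => X _.
rewrite (eq_bigl (fun S : {set 'I_p} => S \in [set A : {set 'I_p} | #|A| == k]%SET));
  last by move=> S; rewrite inE andbT.
rewrite sumr_const card_draws card_ord -[LHS]mulr_natr divfK //.
by rewrite pnatr_eq0 -lt0n bin_gt0.
Qed.

Definition not_defective p (I : option 'I_p) (S : {set 'I_p}) : bool :=
  if I is Some j then j \notin S else false.

(* Main.v *)
(* Draw c independent bundles of about p/k items each, with replacement. Give
   the positions of a bundle distinct codes of about log2 (p/k) bits, and for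
   each bit and each value of it test together the items whose positions carry
   that value. A bundle containing exactly one defective item then reveals it,
   which happens with probability at least (1 - k/p)/e, since
   b x (1 - x)^(b - 1) is close to 1/e for x = k/p and b = p/k. The decoder
   names an item only if every consistent defective set contains it, so it
   never errs and stays silent only when all c bundles fail. The factor 1 + eta
   in the number of tests absorbs the rounding of the code length. *)

Require Import Defs.
From HB Require Import structures.
From mathcomp Require Import all_boot all_order all_algebra.
From mathcomp Require Import all_classical all_reals all_analysis.
From mathcomp Require Import ring lra.

Set Implicit Arguments.
Unset Strict Implicit.
Unset Printing Implicit Defensive.

Import Order.TTheory GRing.Theory Num.Theory.
Import numFieldNormedType.Exports.

Local Open Scope classical_set_scope.
Local Open Scope ring_scope.

(** * Zero-error decoding *)

Definition sure_decoder n p (k : nat) : decoder n p := fun X Y =>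
  [pick j | [forall S : {set 'I_p},
     (#|S| == k) && (outcomes X S == Y) ==> (j \in S)]].

(** The true set is itself consistent with the outcomes, so it contains every item common to all
    consistent sets. *)
Lemma sure_decoder_sound n p k (X : test_matrix n p) (S : {set 'I_p}) :
  #|S| = k -> not_defective (estimate (sure_decoder k) X S) S = false.
Proof.
rewrite /estimate /sure_decoder => Sk; case: pickP => [j /forallP/(_ S)|//].
by rewrite Sk !eqxx /= => ->.
Qed.

(** The decoder may pick another item than [j]; [j] only witnesses that there is something to
    pick. *)
Lemma sure_decoder_answers n p k (X : test_matrix n p) (S : {set 'I_p}) j :
  (forall S', outcomes X S' = outcomes X S -> j \in S') ->
  (estimate (sure_decoder k) X S == None) = false.
Proof.
rewrite /estimate /sure_decoder => sure_j; case: pickP => [//|/(_ j)/negP[]].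
by apply/forallP => S'; apply/implyP => /andP[_ /eqP/sure_j].
Qed.

Lemma gt_prob_sure_decoder (R : realType) n p k (mu : random_design R n p) :
  gt_prob k mu
    (fun X S => not_defective (estimate (sure_decoder k) X S) S) = 0.
Proof.
apply: big1 => X _; apply: big_pred0 => S.
by apply/negP => /andP[/eqP/sure_decoder_sound ->].
Qed.

Lemma gt_prob_le1 (R : realType) n p k (mu : random_design R n p) E :
  (k <= p)%N -> gt_prob k mu E <= 1.
Proof.
move=> kp; rewrite -(gt_prob_total mu kp); apply: ler_sum => X _.
rewrite [leRHS](bigID (E X)) /=.
rewrite (eq_bigl (fun S : {set 'I_p} => (#|S| == k) && true && E X S));
  last first.
  by move=> S; rewrite andbT.
rewrite lerDl; apply: sumr_ge0 => S _.
by rewrite divr_ge0 // design_mass_ge0.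
Qed.

(** * Designs generated from a uniform random seed *)

Section UniformDesign.
Variables (R : realType) (n p : nat) (F : finType) (M : F -> 'M[bool]_(n, p)).
Hypothesis F_gt0 : (0 < #|F|)%N.

(** The image under [M] of the uniform law on the seeds [F]. *)
Let mass X : R := \sum_(f | M f == X) #|F|%:R^-1.

Let mass_ge0 X : 0 <= mass X.
Proof. by apply: sumr_ge0 => f _; rewrite invr_ge0. Qed.

Let mass_sum1 : \sum_X mass X = 1.
Proof.
transitivity (\sum_(f : F) (#|F|%:R^-1 : R)).
  by rewrite (partition_big M xpredT).
rewrite sumr_const -[LHS]mulr_natl mulfV //.
by rewrite pnatr_eq0 -lt0n.
Qed.

Definition uniform_design := RandomDesign mass_ge0 mass_sum1.

(** Exchanging the sums makes the probability an average over [S], so bounding the fraction of bad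
    seeds for each fixed [S] is enough. *)
Lemma gt_prob_uniform_design_le k E (q : R) : (k <= p)%N ->
  (forall S : {set 'I_p}, #|S| = k ->
     #|[pred f | E (M f) S]|%:R <= q * #|F|%:R) ->
  gt_prob k uniform_design E <= q.
Proof.
move=> kp leq; have C0 : 'C(p, k)%:R != 0 :> R.
  by rewrite pnatr_eq0 -lt0n bin_gt0.
have -> : gt_prob k uniform_design E =
    \sum_(S : {set 'I_p} | #|S| == k)
      #|[pred f | E (M f) S]|%:R / #|F|%:R / 'C(p, k)%:R.
  rewrite /gt_prob; under eq_bigr do rewrite big_mkcondr.
  rewrite exchange_big /=; apply: eq_bigr => S _.
  rewrite -big_mkcond -mulr_suml; congr (_ / _).
  rewrite (eq_bigr (fun X =>
    \sum_(f | E (M f) S && (M f == X)) (#|F|%:R^-1 : R))); last first.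
    move=> X EX; apply: eq_bigl => f.
    by case: eqP => [->|]; rewrite ?EX ?andbF.
  transitivity (\sum_(f | E (M f) S) (#|F|%:R^-1 : R)).
    by rewrite (partition_big M (E^~ S)).
  by rewrite sumr_const -[LHS]mulr_natl.
apply: (@le_trans _ _ (\sum_(S : {set 'I_p} | #|S| == k) q / 'C(p, k)%:R)).
  apply: ler_sum => S /eqP Sk; rewrite ler_wpM2r ?invr_ge0 //.
  by rewrite ler_pdivrMr ?ltr0n // leq.
rewrite (eq_bigl (fun S : {set 'I_p} =>
  S \in [set A : {set 'I_p} | #|A| == k]%SET)); last by move=> S; rewrite inE.
by rewrite sumr_const card_draws card_ord -[leLHS]mulr_natr divfK.
Qed.

End UniformDesign.

(** * Counting the draws with a single hit *)

Definition hits_once (T U : finType) (S : {set U}) (g : {ffun T -> U}) :=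
  #|[pred t | g t \in S]| == 1%N.

(** Choose the hit position, a value in [S] there, and values outside [S] elsewhere. *)
Lemma card_hits_once (T U : finType) (S : {set U}) :
  #|[pred g : {ffun T -> U} | hits_once S g]| =
  (#|T| * (#|S| * #|~: S| ^ #|T|.-1))%N.
Proof.
pose A (t t' : T) : {pred U} := if t' == t then mem S else mem (~: S)%SET.
have hitsP t (g : {ffun T -> U}) :
    hits_once S g && (g t \in S) = (g \in family (A t)).
  apply/andP/familyP => [[/eqP g1 gt] t'|gA].
    rewrite /A; case: eqP => [->//|/eqP t't].
    apply/negPn/negP; rewrite inE negbK => gt'.
    have /card_le1_eqP/(_ t t') /= : (#|[pred t | g t \in S]| <= 1)%N.
      by rewrite g1.
    by rewrite !inE gt gt' => /(_ isT isT) /eqP; rewrite (negPf t't).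
  have := gA t; rewrite /A eqxx => gt; split=> //.
  apply/eqP; apply: (@fintype.eq_card1 _ t) => t'.
  rewrite !inE; case: eqP => [->//|/eqP t't].
  by have := gA t'; rewrite /A (negPf t't) inE => /negbTE.
rewrite -[LHS]sum1_card.
(* The inner sum counts the hits of [g], hence is 1; exchanging the sums then fixes the hit
   position. *)
transitivity (\sum_(g : {ffun T -> U} | hits_once S g)
                \sum_(t | g t \in S) 1)%N.
  by apply: eq_big => [g|g /eqP]; rewrite ?inE // sum1_card => ->.
under eq_bigr do rewrite big_mkcond.
rewrite exchange_big /=.
transitivity (\sum_(t : T) #|S| * #|~: S| ^ #|T|.-1)%N; last first.
  by rewrite sum_nat_const.
apply: eq_bigr => t _; rewrite -big_mkcondr /=.
rewrite (eq_bigl _ _ (hitsP t)) sum1_card card_family foldrE big_image /=.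
rewrite (bigD1 t) //= /A eqxx; congr (_ * _)%N.
rewrite (eq_bigr (fun=> #|~: S|)) => [|t' /negPf->//].
by rewrite prod_nat_const cardC1.
Qed.

(** * The bundle test matrix and its success probability *)

Section BundleMatrix.
Variables (n p : nat) (G T B : finType).
Implicit Types f : {ffun G -> {ffun T -> 'I_p}}.
Variables (code : T -> B -> bool) (idx : G * B * bool -> 'I_n).
Hypotheses (idx_inj : injective idx)
  (code_inj : forall t t', code t =1 code t' -> t = t').

(** An item may occupy several positions of a bundle. Tests outside the range of [idx] are empty
    padding. *)
Definition bundle_matrix f : 'M[bool]_(n, p) :=
  \matrix_(i, j) [exists u, (idx u == i) &&
    [exists t, (f u.1.1 t == j) && (code t u.1.2 == u.2)]].

Lemma outcomes_bundle_matrix f S l r v :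
  outcomes (bundle_matrix f) S (idx (l, r, v)) =
  [exists t, (f l t \in S) && (code t r == v)].
Proof.
rewrite ffunE; apply/existsP/existsP => [[j /andP[jS]]|[t /andP[ftS crt]]].
  rewrite mxE => /existsP[u /andP[/eqP/idx_inj->]].
  by case/existsP => t /andP[/eqP ftj crt]; exists t; rewrite ftj jS.
exists (f l t); rewrite ftS mxE /=; apply/existsP; exists (l, r, v).
by rewrite eqxx /=; apply/existsP; exists t; rewrite eqxx.
Qed.

(* A bundle with a single defective position shows its code and exactly one
   positive test in each pair; any other set of hit positions of the bundle
   would leave a pair all negative, make a pair all positive, or show
   another code. *)
Lemma bundle_matrix_hits_once f (S : {set 'I_p}) l (r0 : B) :
  hits_once S (f l) -> exists j, forall S',
  outcomes (bundle_matrix f) S' = outcomes (bundle_matrix f) S -> j \in S'.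
Proof.
move=> hit1; have /card1P[t hit] := hit1.
have ftS : f l t \in S by have := hit t; rewrite !inE eqxx.
exists (f l t) => S' /ffunP eqY.
(* The bit [r0] provides a test positive for [S], so [S'] must hit bundle [l] too, at some [t']. *)
have: outcomes (bundle_matrix f) S' (idx (l, r0, code t r0)).
  rewrite eqY outcomes_bundle_matrix; apply/existsP.
  by exists t; rewrite ftS eqxx.
rewrite outcomes_bundle_matrix => /existsP[t' /andP[ft'S' _]].
suff -> : t = t' by [].
(* If the codes differ at [r], the test of the value [code t' r] is positive for [S'], but the only
   hit [t] of [S] is not in it. *)
apply: code_inj => r; apply/eqP/negPn/negP => neq.
have: outcomes (bundle_matrix f) S' (idx (l, r, code t' r)).
  by rewrite outcomes_bundle_matrix; apply/existsP; exists t'; rewrite ft'S' /=.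
rewrite eqY outcomes_bundle_matrix => /existsP[t'' /andP[ft''S /eqP eqc]].
have := hit t''; rewrite !inE ft''S => /esym/eqP eqt.
by move: neq; rewrite -eqc eqt eqxx.
Qed.

End BundleMatrix.

(** For fixed [S], a silent seed maps every bundle index to a draw without a single hit; counting
    such maps gives the [c]-th power. The 2 in [c * m * 2] counts the values of a bit. *)
Lemma bundle_design (R : realType) n p k c m b : (0 < p)%N -> (k <= p)%N ->
  (c * m * 2 <= n)%N -> (0 < m)%N -> (b <= 2 ^ m)%N ->
  exists mu : random_design R n p,
  gt_prob k mu (fun X S => estimate (sure_decoder k) X S == None) <=
  (1 - b%:R * ((k%:R / p%:R) * (1 - k%:R / p%:R) ^+ b.-1)) ^+ c.
Proof.
move=> p_gt0 kp len m_gt0 leb.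
have leT : (#|{: 'I_c * 'I_m * bool}| <= n)%N.
  by rewrite !card_prod !card_ord card_bool.
have leC : (b <= #|{ffun 'I_m -> bool}|)%N.
  by rewrite card_ffun card_bool card_ord.
pose idx (u : 'I_c * 'I_m * bool) : 'I_n := widen_ord leT (enum_rank u).
pose code (t : 'I_b) (r : 'I_m) : bool := (enum_val (widen_ord leC t)) r.
have idx_inj : injective idx.
  by move=> u v /(congr1 val) /= /val_inj /enum_rank_inj.
have code_inj t t' : code t =1 code t' -> t = t'.
  by move=> /ffunP/enum_val_inj /(congr1 val) /= /val_inj.
pose F := {ffun 'I_c -> {ffun 'I_b -> 'I_p}}.
have cardF : #|{: F}| = ((p ^ b) ^ c)%N by rewrite !card_ffun !card_ord.
have F_gt0 : (0 < #|{: F}|)%N by rewrite cardF !expn_gt0 p_gt0.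
exists (uniform_design R (bundle_matrix (p := p) code idx) F_gt0).
apply: gt_prob_uniform_design_le => // S Sk.
pose A := [predC [pred g : {ffun 'I_b -> 'I_p} | hits_once S g]].
have cardA : #|A|%:R =
    (1 - b%:R * ((k%:R / p%:R) * (1 - k%:R / p%:R) ^+ b.-1)) * p%:R ^+ b :> R.
  have p0 : p%:R != 0 :> R by rewrite pnatr_eq0 -lt0n.
  have := cardC [pred g : {ffun 'I_b -> 'I_p} | hits_once S g].
  rewrite card_ffun card_hits_once !card_ord [#|~: S|]cardsCs finset.setCK.
  rewrite Sk card_ord => /(congr1 (fun i => i%:R : R)).
  rewrite natrD !natrM !natrX natrB // => eqA.
  rewrite -[LHS](addKr (b%:R * (k%:R * (p%:R - k%:R) ^+ b.-1))) eqA.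
  rewrite mulrBl mul1r addrC; congr (_ - _).
  (* For [b = 0] the truncated [b.-1] is harmless, as the factor [b] kills both sides. *)
  case: (b) => [|b']; first by rewrite !mul0r.
  rewrite -[RHS]mulrA; congr (_ * _); rewrite /= exprS mulrACA divfK //.
  by rewrite -exprMn mulrBl mul1r divfK.
rewrite cardF !natrX -exprMn -cardA -natrX ler_nat.
rewrite -[c in (_ ^ c)%N]card_ord -card_ffun_on; apply: subset_leq_card.
apply/fintype.subsetP => f; rewrite !inE => none; apply/ffun_onP => l.
rewrite !inE; apply/negP => hit.
have [j /sure_decoder_answers answers] :=
  bundle_matrix_hits_once idx_inj code_inj (Ordinal m_gt0) hit.
by rewrite answers in none.
Qed.

(** * Estimates for the hit probability and the code length *)

Lemma bundle_hit_prob_ge (R : realType) (p k : nat) :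
  (0 < k)%N -> (k < p)%N ->
  (1 - k%:R / p%:R) * expR (- 1) <=
  (p %/ k)%:R * (k%:R / p%:R * (1 - k%:R / p%:R) ^+ (p %/ k).-1) :> R.
Proof.
move=> k_gt0 kp; set x : R := k%:R / p%:R; set b := (p %/ k)%N.
have p_gt0 : 0 < p%:R :> R by rewrite ltr0n (ltn_trans k_gt0 kp).
have x_gt0 : 0 < x by rewrite divr_gt0 // ltr0n.
have x_lt1 : 0 < 1 - x by rewrite subr_gt0 ltr_pdivrMr // mul1r ltr_nat.
have xE : x * p%:R = k%:R by rewrite divfK // gt_eqF.
have b_gt0 : (0 < b)%N by rewrite divn_gt0 // ltnW.
have bx_le1 : b%:R * x <= 1.
  by rewrite /x mulrA ler_pdivrMr // mul1r -natrM ler_nat leq_divM.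
have bx_ge : 1 - x <= b%:R * x.
  rewrite lerBlDr -[X in _ + X]mul1r -mulrDl natr1 /x mulrA ler_pdivlMr //.
  rewrite mul1r -natrM ler_nat.
  by rewrite ltnW // ltn_ceil.
have bE : b%:R = b.-1%:R + 1 :> R by rewrite -{1}(prednK b_gt0) -natr1.
rewrite mulrA ler_pM ?expR_ge0 ?(ltW x_lt1) //.
(* Invert [1 + u <= expR u] at [u = x / (1 - x)], where [1 + u] is the inverse of [1 - x]. *)
have le1x : expR (- (x / (1 - x))) <= 1 - x.
  rewrite expRN -[leRHS]invrK lef_pV2 ?posrE ?invr_gt0 ?expR_gt0 //.
  apply: le_trans (expR_ge1Dx _); rewrite le_eqVlt; apply/predU1P; left.
  by field; rewrite lt0r_neq0.
apply: le_trans (_ : expR (- (x / (1 - x))) ^+ b.-1 <= _); last first.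
  by rewrite lerXn2r ?nnegrE ?expR_ge0 // ltW.
(* The exponent is at least -1 because [b x <= 1] means [(b - 1) x <= 1 - x]. *)
rewrite -expRM_natl ler_expR mulrN lerN2 mulrA ler_pdivrMr // mul1r.
by move: bx_le1; rewrite bE mulrDl mul1r lerBrDr.
Qed.

(** Rounding [n / (2 c)] down loses at most 1, which the surplus [eta * log2 y >= 1] repays. *)
Lemma ratio_le_exp2 (R : realType) (eta y : R) (c n : nat) :
  (0 < c)%N -> 0 < y -> ln 2 <= eta * ln y ->
  (1 + eta) * (2 * c%:R * log2 y) <= n%:R -> y <= 2 ^+ (n %/ (2 * c)).
Proof.
move=> c_gt0 y_gt0 le_ln le_n.
have ln2_gt0 : 0 < ln 2 :> R by rewrite ln_gt0 // ltr1n.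
have c2_gt0 : (0 < 2 * c)%N by rewrite muln_gt0.
have c2R : 0 < (2 * c)%:R :> R by rewrite ltr0n.
rewrite -ler_ln ?posrE ?exprn_gt0 ?ltr0n // lnXn ?ltr0n //.
have : n%:R <= ((n %/ (2 * c)).+1 * (2 * c))%:R :> R.
  by rewrite ler_nat ltnW // ltn_ceil.
move=> /(le_trans le_n); rewrite natrM -[2 * c%:R]natrM mulrCA mulrC.
rewrite ler_pM2r // /log2 mulrA ler_pdivrMr // -natr1 mulrDl mul1r -mulr_natl.
by rewrite mulrDl mul1r => ?; lra.
Qed.

Theorem theorem3 (R : realType) (eta : R) (c : nat) (k n : nat -> nat)
    (eta_gt0 : 0 < eta) (c_gt0 : (0 < c)%N)
    (k_le : forall p, (k p <= p)%N)
    (k_infty : k p @[p --> \oo] --> \oo)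
    (k_small : ((k p)%:R / p%:R : R) @[p --> \oo] --> (0 : R))
    (n_ge : forall p,
       (1 + eta) * (2 * c%:R * log2 (p%:R / (k p)%:R)) <= (n p)%:R) :
  exists (mu : forall p, random_design R (n p) p)
         (D : forall p, decoder (n p) p)
         (eps : nat -> R),
    [/\ eps p @[p --> \oo] --> (0 : R),
        forall p, gt_prob (k p) (mu p)
          (fun X S => not_defective (estimate (D p) X S) S) = 0 &
        forall p, gt_prob (k p) (mu p)
          (fun X S => estimate (D p) X S == None)
          <= (1 - expR (- 1) + eps p) ^+ c].
Proof.
pose x p : R := (k p)%:R / p%:R.
(* The bound 1/2 yields [k p < p] and a positive code length; the last one is the surplus condition
   [ln 2 <= eta * ln (p / k)]. *)
pose good p := [&& (0 < k p)%N, x p < 2^-1 & x p < expR (- (ln 2 / eta))].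
(* From [1 - (1 - x) / e = 1 - 1/e + x/e]; the value at the finitely many other [p] makes the
   claimed bound 1. *)
pose eps p : R := expR (- 1) * (if good p then x p else 1).
have mu p : {mu : random_design R (n p) p |
    gt_prob (k p) mu
      (fun X S => estimate (@sure_decoder (n p) p (k p)) X S == None)
    <= (1 - expR (- 1) + eps p) ^+ c}.
  apply: cid; rewrite /eps; case: ifPn => [/and3P[k_gt0 x_half x_small]|_].
    have p_gt0 : (0 < p)%N := leq_trans k_gt0 (k_le p).
    have kR : 0 < (k p)%:R :> R by rewrite ltr0n.
    have pR : 0 < p%:R :> R by rewrite ltr0n.
    have x_gt0 : 0 < x p by rewrite divr_gt0.
    have y_gt0 : 0 < p%:R / (k p)%:R :> R by rewrite divr_gt0.
    have yE : p%:R / (k p)%:R = (x p)^-1 by rewrite invf_div.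
    have kp : (k p < p)%N.
      by move: x_half; rewrite ltr_pdivrMr // -(ltr_nat R) => ?; lra.
    have le_ln : ln 2 <= eta * ln (p%:R / (k p)%:R) :> R.
      rewrite yE lnV ?posrE // mulrC -ler_pdivrMr // lerNr.
      by rewrite -[leRHS]expRK ler_ln ?posrE ?expR_gt0 // ltW.
    have le2m := ratio_le_exp2 c_gt0 y_gt0 le_ln (n_ge p).
    set m := (n p %/ (2 * c))%N in le2m.
    have m_gt0 : (0 < m)%N.
      rewrite lt0n; apply/eqP => m0; move: le2m; rewrite m0 expr0 yE.
      rewrite invf_le1 // => ?; lra.
    have leb : (p %/ k p <= 2 ^ m)%N.
      rewrite -(ler_nat R) natrX; apply: le_trans le2m.
      by rewrite ler_pdivlMr // -natrM ler_nat leq_divM.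
    have len : (c * m * 2 <= n p)%N.
      by rewrite mulnC mulnA mulnC leq_divM.
    have [mu le_mu] := bundle_design R p_gt0 (k_le p) len m_gt0 leb.
    exists mu; apply: le_trans le_mu _.
    have := bundle_hit_prob_ge R k_gt0 kp; rewrite -/(x p) => hit_ge.
    (* Keeps the failure probability nonnegative, so that taking [c]-th powers is monotone. *)
    have hit_le1 : (p %/ k p)%:R * (x p * (1 - x p) ^+ (p %/ k p).-1) <= 1.
      have bx_le1 : (p %/ k p)%:R * x p <= 1.
        by rewrite mulrA ler_pdivrMr // mul1r -natrM ler_nat leq_divM.
      have [x_ge0 x_le1] : 0 <= 1 - x p /\ 1 - x p <= 1 by split; lra.
      by rewrite mulrA mulr_ile1 ?mulr_ge0 ?ler0n ?(ltW x_gt0) ?exprn_ge0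
        ?exprn_ile1.
    by apply: lerXn2r; rewrite ?nnegrE; lra.
  have one : (0 < #|{: unit}|)%N by rewrite card_unit.
  exists (uniform_design R (fun=> const_mx false) one).
  by rewrite mulr1 subrK expr1n gt_prob_le1.
exists (fun p => sval (mu p)), (fun p => sure_decoder (k p)), eps; split.
- have good_near : \forall p \near \oo, good p.
    near=> p; apply/and3P; split; near: p.
    + by move/cvgnyPgt: k_infty; apply.
    + by apply: cvgr_lt k_small _ _; rewrite invr_gt0 ltr0n.
    + by apply: cvgr_lt k_small _ _; rewrite expR_gt0.
  apply: (@cvg_trans _ (expR (- 1) * x p @[p --> \oo])).
    apply: near_eq_cvg; near=> p; rewrite /eps ifT //.
    by near: p.
  have : expR (- 1) * x p @[p --> \oo] --> expR (- 1) * 0.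
    exact: cvgM (cvg_cst _) k_small.
  by rewrite mulr0.
- by move=> p; apply: gt_prob_sure_decoder.
- by move=> p; exact: (svalP (mu p)).
Unshelve. all: by end_near.
Qed.
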